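(* Let $A\in\mathbb{R}^{n\times d}$ with $\mathrm{rank}(A)=d$, $b\in\mathbb{R}^n$, $\mathcal{Z}\subseteq\mathbb{R}^d$ nonempty, closed and convex, $f(x)=\|Ax-b\|_1$, and let $x^\ast$ be an optimal solution of $\min_{x\in\mathcal{Z}}f(x)$; suppose $f(x^\ast)>0$. Let $R,F\in\mathbb{R}^{d\times d}$ be nonsingular with $U=AR^{-1}$ a well-conditioned basis, let $H=(FF^\top)^{-1}$, let $\lambda_1,\dots,\lambda_n$ be approximate $\ell_1$ leverage scores with approximation factor $\gamma\in[0,1)$, and let $x_0\in\mathcal{Z}$. Then for every $\epsilon>0$ there exists a step-size $\eta$ such that after $$T=d\,\bar\kappa_1^2(U)\,\hat\kappa^2(RF)\,\frac{c_1^2c_2c_3^2}{\epsilon^2}$$ iterations, the algorithm pwSGD with $p=1$ returns $\bar x$ satisfying $$\frac{\mathbb{E}[f(\bar x)]-f(x^\ast)}{f(x^\ast)}\le\epsilon,$$ where the expectation is over all samples $\xi_t$ drawn by the algorithm, and $$c_1=\frac{1+\gamma}{1-\gamma},\qquad c_2=\frac{\|x^\ast-x_0\|_H^2}{\|x^\ast\|_H^2},\qquad c_3=\frac{\|Ax^\ast\|_1}{f(x^\ast)}.$$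
   Context: Notation: $A_i$, $U_i$ are $i$-th rows; $|M|_1=\sum_{i,j}|M_{ij}|$ is the entrywise $\ell_1$ norm; $\hat\kappa(M)=|M|_1|M^{-1}|_1$ for nonsingular $M$; $\|x\|_H^2=x^\top Hx$. Conditioning: $U\in\mathbb{R}^{n\times d}$ is $(\alpha,\beta,1)$-conditioned if $|U|_1\le\alpha$ and $\beta\|Ux\|_1\ge\|x\|_\infty$ for all $x\in\mathbb{R}^d$; $\bar\kappa_1(U)$ is the minimum of $\alpha\beta$ over all such $\alpha,\beta$. $U$ is called a well-conditioned basis for $\mathrm{range}(A)$ if it is a basis and $\bar\kappa_1(U)$ is a low-degree polynomial in $d$ independent of $n$ (a qualitative requirement). Approximate leverage scores with factor $\gamma$: $(1-\gamma)\|U_i\|_1\le\lambda_i\le(1+\gamma)\|U_i\|_1$ for all $i$. Algorithm pwSGD ($p=1$): set $p_i=\lambda_i/\sum_j\lambda_j$. Starting from $x_0\in\mathcal{Z}$, for $t=0,1,2,\dots$ draw $\xi_t\in\{1,\dots,n\}$ independently from the distribution $\{p_i\}$, put $c^{(t)}=\mathrm{sgn}(A_{\xi_t}x_t-b_{\xi_t})/p_{\xi_t}$, and set $$x_{t+1}=\arg\min_{x\in\mathcal{Z}}\ \eta\,c^{(t)}A_{\xi_t}x+\tfrac12\|x_t-x\|_H^2,$$ which for $\mathcal{Z}=\mathbb{R}^d$ is $x_{t+1}=x_t-\eta\,c^{(t)}H^{-1}A_{\xi_t}^\top$. The output is the average of the iterates, $\bar x=\frac{1}{T+1}\sum_{t=0}^{T}x_t$.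 If the displayed $T$ is not an integer, ''after $T$ iterations'' is read with $T$ replaced by any integer at least as large. The definition of $c_2$ presupposes $x^\ast\neq0$. *)

(* Defs.v *)
From HB Require Import structures.
From mathcomp Require Import all_boot all_order all_algebra.
From mathcomp Require Import finmap.
From mathcomp Require Import all_classical all_reals all_analysis.
Import Order.TTheory GRing.Theory Num.Theory.
Import numFieldNormedType.Exports.

Set Implicit Arguments.
Unset Strict Implicit.
Unset Printing Implicit Defensive.

Local Open Scope classical_set_scope.
Local Open Scope ring_scope.

(* On a row or a column this is the usual vector l1 norm. *)
Definition norm1 (K : realType) (m n : nat) (M : 'M[K]_(m, n)) : K :=
  \sum_(i < m) \sum_(j < n) `|M i j|.

Definition sqnorm (K : realType) (d : nat) (H : 'M[K]_d) (x : 'cV[K]_d) : K :=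
  (x^T *m H *m x) ord0 ord0.

(* Only meaningful for nonsingular M, since invmx M = M otherwise. *)
Definition kappa_hat (K : realType) (d : nat) (M : 'M[K]_d) : K :=
  norm1 M * norm1 (invmx M).

(* The MathComp-Analysis norm `|x| on matrices is the entrywise maximum, so for
   a column vector it is the l-infinity norm. *)
Definition conditioned1 (K : realType) (n d : nat) (alpha beta : K)
    (U : 'M[K]_(n, d)) : Prop :=
  norm1 U <= alpha /\
  forall x : 'cV[K]_d, `|x| <= beta * norm1 (U *m x).

(* For U of full column rank and d > 0 this infimum is a minimum: it is reached
   at alpha = norm1 U and beta the least admissible value. *)
Definition kappa_bar1 (K : realType) (n d : nat) (U : 'M[K]_(n, d)) : K :=
  inf [set k | exists alpha beta,
         conditioned1 alpha beta U /\ k = alpha * beta].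

(* The columns of U form a basis of the column space of A.  That kappa_bar1 U
   be a low-degree polynomial in d, independent of n, is a qualitative
   requirement on families of matrices; the polynomial q is a parameter. *)
Definition well_conditioned_basis (K : realType) (q : {poly K}) (n d : nat)
    (A U : 'M[K]_(n, d)) : Prop :=
  [/\ row_free U^T, (U^T :=: A^T)%MS & kappa_bar1 U <= q.[d%:R]].

Definition approx_leverage_scores (K : realType) (n d : nat) (gamma : K)
    (U : 'M[K]_(n, d)) (lambda : 'I_n -> K) : Prop :=
  forall i, (1 - gamma) * norm1 (row i U) <= lambda i
            <= (1 + gamma) * norm1 (row i U).

Definition l1_objective (K : realType) (n d : nat) (A : 'M[K]_(n, d))
    (b : 'cV[K]_n) (x : 'cV[K]_d) : K :=
  norm1 (A *m x - b).

Definition is_argmin (K : realType) (V : Type) (Z : set V) (g : V -> K)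
    (x : V) : Prop :=
  Z x /\ forall y, Z y -> g x <= g y.

Section pwSGD.
Variables (K : realType) (n d : nat) (A : 'M[K]_(n, d)) (b : 'cV[K]_n).
Variables (Z : set 'cV[K]_d) (H : 'M[K]_d) (p : 'I_n -> K) (eta : K).
Variable x0 : 'cV[K]_d.

(* When p i = 0 this is 0, the inverse of 0 being 0; such an index is drawn with
   probability 0. *)
Definition pwsgd_coef (x : 'cV[K]_d) (i : 'I_n) : K :=
  Num.sg ((A *m x - b) i ord0) / p i.

Definition pwsgd_model (x : 'cV[K]_d) (i : 'I_n) (y : 'cV[K]_d) : K :=
  eta * pwsgd_coef x i * (row i A *m y) ord0 ord0 + 2^-1 * sqnorm H (x - y).

(* For H positive definite and Z nonempty, closed and convex there is exactly
   one minimizer; xget selects it (its default value x is never used then). *)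
Definition pwsgd_step (x : 'cV[K]_d) (i : 'I_n) : 'cV[K]_d :=
  xget x (is_argmin Z (pwsgd_model x i)).

(* s t is the index drawn at iteration t. *)
Fixpoint pwsgd_iter (s : nat -> 'I_n) (t : nat) : 'cV[K]_d :=
  if t is t'.+1 then pwsgd_step (pwsgd_iter s t') (s t') else x0.

Definition pwsgd_output (s : nat -> 'I_n) (T : nat) : 'cV[K]_d :=
  T.+1%:R^-1 *: \sum_(t < T.+1) pwsgd_iter s t.

End pwSGD.

(* xi t is the random index drawn at time t.  For variables with values in a
   finite set, it is enough to state measurability and the product rule on
   events of the form xi t = i. *)
Definition iid_draws (K : realType) (disp : measure_display)
    (Omega : measurableType disp) (P : probability Omega K) (n : nat)
    (p : 'I_n -> K) (xi : nat -> Omega -> 'I_n) : Prop :=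
  [/\ forall t i, measurable (xi t @^-1` [set i]),
      forall t i, P (xi t @^-1` [set i]) = (p i)%:E &
      forall (J : {fset nat}) (i : nat -> 'I_n),
        P (\bigcap_(t in [set` J]) (xi t @^-1` [set i t])) =
        (\prod_(t <- J) P (xi t @^-1` [set i t]))%E].

(* Main.v *)
Require Import Defs.
From HB Require Import structures.
From mathcomp Require Import all_boot all_order all_algebra.
From mathcomp Require Import finmap.
From mathcomp Require Import all_classical all_reals all_analysis.
From mathcomp Require Import measurable_realfun ring lra.
Import Order.TTheory GRing.Theory Num.Theory.
Import numFieldNormedType.Exports.

(** One step of pwSGD is the [H]-orthogonal projection onto [Z] of an unconstrained
    gradient step, so it does not increase the distance to [y] in [Z].  Averaging
    over the drawn index turns the linear term into a subgradient of [f], and the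
    quadratic term is at most [(eta G)^2] with [G = c1 |U|_1 |RF|_1], because
    [A_i F = U_i R F] and [p_i] is proportional to [|U_i|_1] up to a factor [c1].
    Hence [2 eta sum_(k < t) (f x_k - f y) + |y - x_t|_H^2 - t (eta G)^2] is a
    supermartingale, which gives
    [E f xbar - f xstar <= (|xstar - x0|_H^2 + N (eta G)^2) / (2 eta N)] for
    [N = T + 1] iterates.  With [e = epsilon f(xstar)] and [eta = e / G^2] this is
    at most [e] as soon as [|xstar - x0|_H^2 G^2 <= N e^2]; the bound on [T] ensures
    it, since [|x|_H <= |(RF)^-1|_1 |R x|_oo] and
    [|U|_1 |R x|_oo <= kappa_bar1 U * |A x|_1]. *)

Set Implicit Arguments.
Unset Strict Implicit.
Unset Printing Implicit Defensive.

Local Open Scope classical_set_scope.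
Local Open Scope ring_scope.

(** * Entrywise [l1] and maximum norms of matrices *)

Section Norms.
Variable K : realType.

Lemma norm1_ge0 m n (M : 'M[K]_(m, n)) : 0 <= norm1 M.
Proof. by apply: sumr_ge0 => i _; apply: sumr_ge0. Qed.

Lemma norm1D m n (M N : 'M[K]_(m, n)) : norm1 (M + N) <= norm1 M + norm1 N.
Proof.
rewrite /norm1 -big_split; apply: ler_sum => i _ /=.
by rewrite -big_split; apply: ler_sum => j _; rewrite mxE ler_normD.
Qed.

Lemma norm1Z m n a (M : 'M[K]_(m, n)) : norm1 (a *: M) = `|a| * norm1 M.
Proof.
rewrite /norm1 mulr_sumr; apply: eq_bigr => i _.
by rewrite mulr_sumr; apply: eq_bigr => j _; rewrite mxE normrM.
Qed.

Lemma norm1_sum m n (I : Type) (r : seq I) (M : I -> 'M[K]_(m, n)) :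
  norm1 (\sum_(i <- r) M i) <= \sum_(i <- r) norm1 (M i).
Proof.
elim: r => [|i r IH]; last first.
  by rewrite !big_cons (le_trans (norm1D _ _))// lerD2l.
by rewrite !big_nil -(scale0r 0) norm1Z normr0 mul0r.
Qed.

Lemma norm1_eq0 m n (M : 'M[K]_(m, n)) : (norm1 M == 0) = (M == 0).
Proof.
apply/idP/eqP => [|->]; last by rewrite -(scale0r 0) norm1Z normr0 mul0r.
rewrite psumr_eq0 => [/allP M0|i _]; last exact: sumr_ge0.
apply/matrixP => i j; rewrite mxE; apply/eqP; rewrite -normr_eq0.
have := M0 i (mem_index_enum _); rewrite psumr_eq0//= => /allP.
by move/(_ j (mem_index_enum _)).
Qed.

Lemma norm1_rows m n (M : 'M[K]_(m, n)) : norm1 M = \sum_i norm1 (row i M).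
Proof.
apply: eq_bigr => i _; rewrite /norm1 big_ord1.
by apply: eq_bigr => j _; rewrite mxE.
Qed.

Lemma norm1_cV m (v : 'cV[K]_m) : norm1 v = \sum_i `|v i ord0|.
Proof. by apply: eq_bigr => i _; rewrite big_ord1. Qed.

Lemma norm1_tr m n (M : 'M[K]_(m, n)) : norm1 M^T = norm1 M.
Proof.
rewrite /norm1 exchange_big; apply: eq_bigr => i _.
by apply: eq_bigr => j _; rewrite mxE.
Qed.

Lemma norm1_mulmx m n l (M : 'M[K]_(m, n)) (N : 'M[K]_(n, l)) :
  norm1 (M *m N) <= norm1 M * norm1 N.
Proof.
rewrite /norm1 mulr_suml; apply: ler_sum => i _; rewrite mulr_suml.
under eq_bigr do rewrite mxE.
apply: (@le_trans _ _ (\sum_j \sum_k `|M i k| * `|N k j|)).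
  apply: ler_sum => j _; apply: (le_trans (ler_norm_sum _ _ _)).
  by apply: ler_sum => k _; rewrite normrM.
rewrite exchange_big; apply: ler_sum => k _; rewrite -mulr_sumr ler_wpM2l//.
by rewrite [leRHS](bigD1 k)//= lerDl sumr_ge0// => i' _; apply: sumr_ge0.
Qed.

Lemma ler_mx_norm m n (M : 'M[K]_(m, n)) i j : `|M i j| <= `|M|.
Proof. by rewrite [leRHS]mx_normrE; apply: (le_bigmax _ _ (i, j)). Qed.

Lemma mx_norm_le m n (M : 'M[K]_(m, n)) a :
  0 <= a -> (forall i j, `|M i j| <= a) -> `|M| <= a.
Proof. by move=> a0 Ma; rewrite [leLHS]mx_normrE; apply: bigmax_le => // -[]. Qed.

Lemma ler_coord_norm1 m n (M : 'M[K]_(m, n)) i j : `|M i j| <= norm1 M.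
Proof.
rewrite /norm1 (bigD1 i)//= (bigD1 j)//= -addrA lerDl addr_ge0//.
  exact: sumr_ge0.
by apply: sumr_ge0 => i' _; apply: sumr_ge0.
Qed.

Lemma mx_norm_le_norm1 m n (M : 'M[K]_(m, n)) : `|M| <= norm1 M.
Proof.
by apply: mx_norm_le => [|i j]; [exact: norm1_ge0|exact: ler_coord_norm1].
Qed.

Lemma norm1_mulmx_cV m n (M : 'M[K]_(m, n)) (v : 'cV[K]_n) :
  norm1 (M *m v) <= norm1 M * `|v|.
Proof.
rewrite norm1_cV /norm1 mulr_suml; apply: ler_sum => i _; rewrite mxE mulr_suml.
apply: (le_trans (ler_norm_sum _ _ _)); apply: ler_sum => k _.
by rewrite normrM ler_wpM2l// ler_mx_norm.
Qed.

Lemma sum_sqr_le_norm1 m (v : 'cV[K]_m) :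
  \sum_i (v i ord0) ^+ 2 <= norm1 v ^+ 2.
Proof.
rewrite norm1_cV expr2 mulr_suml; apply: ler_sum => i _.
rewrite -real_normK ?num_real// expr2 ler_wpM2l//.
by rewrite (bigD1 i)//= lerDl sumr_ge0.
Qed.

End Norms.

(** * Expectation over finitely many independent draws, as a finite sum *)

Section Draws.
Variables (K : realType) (n : nat) (p : 'I_n -> K) (i0 : 'I_n).

(* Times from [T] on get the dummy index [i0]. *)
Definition draws_ext (T : nat) (s : {ffun 'I_T -> 'I_n}) (t : nat) : 'I_n :=
  oapp s i0 (insub t).

(** For [g] depending on the draws up to time [T], summing [p i * g (draws_set s T i)] over [i]
    gives the conditional mean of [g] given the earlier draws. *)
Definition draws_set (s : nat -> 'I_n) (T : nat) (i : 'I_n) (t : nat) : 'I_n :=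
  if t == T then i else s t.

Definition draws_mean (T : nat) (g : (nat -> 'I_n) -> K) : K :=
  \sum_(s : {ffun 'I_T -> 'I_n}) (\prod_t p (s t)) * g (draws_ext s).

Lemma draws_extE T (s : {ffun 'I_T -> 'I_n}) (t : 'I_T) : draws_ext s t = s t.
Proof. by rewrite /draws_ext valK. Qed.

Lemma draws_mean0 g : draws_mean 0 g = g (fun=> i0).
Proof.
have s0 : all_equal_to ([ffun=> i0] : {ffun 'I_0 -> 'I_n}).
  by move=> s; apply/ffunP => -[].
rewrite /draws_mean (bigD1 [ffun=> i0])//= [X in _ + X]big1 ?addr0 => [|s]; last first.
  by rewrite (s0 s) eqxx.
rewrite big_ord0 mul1r; congr g; apply/funext => t.
by rewrite /draws_ext insubF.
Qed.

(** Tower rule: [T.+1] draws are [T] draws followed by a last one, and the weight factors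
    accordingly. *)
Lemma draws_meanS T g : draws_mean T.+1 g =
  draws_mean T (fun s => \sum_i p i * g (draws_set s T i)).
Proof.
pose snoc (q : {ffun 'I_T -> 'I_n} * 'I_n) : {ffun 'I_T.+1 -> 'I_n} :=
  [ffun k => oapp q.1 q.2 (unlift ord_max k)].
pose split (s : {ffun 'I_T.+1 -> 'I_n}) :=
  ([ffun k => s (lift ord_max k)] : {ffun 'I_T -> 'I_n}, s ord_max).
have snocK : cancel snoc split.
  move=> [u i]; rewrite /split /snoc /= ffunE unlift_none; congr pair.
  by apply/ffunP => k; rewrite !ffunE liftK.
have splitK : cancel split snoc.
  move=> s; apply/ffunP => k; rewrite ffunE.
  by case: unliftP => [j|] -> //=; rewrite ffunE.
rewrite /draws_mean (reindex snoc); last first.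
  by apply: onW_bij; exists split.
under [RHS]eq_bigr do rewrite mulr_sumr.
rewrite pair_bigA; apply: eq_bigr => -[u i] _ /=.
rewrite mulrA; congr (_ * g _).
  rewrite big_ord_recr /= ffunE unlift_none /=; congr (_ * _).
  apply: eq_bigr => k _; rewrite ffunE.
  have -> : widen_ord (leqnSn T) k = lift ord_max k.
    by apply: ord_inj; rewrite lift_max.
  by rewrite liftK.
apply/funext => t; rewrite /draws_set; case: eqP => [->|/eqP tT].
  by rewrite -[T]/(val (@ord_max T)) draws_extE ffunE unlift_none.
have [ltT|geT] := ltnP t T; last first.
  by rewrite /draws_ext !insubF// ltnNge ?geT// ltn_neqAle eq_sym tT geT.
have -> : t = lift ord_max (Ordinal ltT) by rewrite lift_max.
by rewrite [LHS]draws_extE ffunE liftK lift_max draws_extE.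
Qed.

Hypothesis p_ge0 : forall i, 0 <= p i.

Lemma draws_mean_le T g h :
  (forall s, g s <= h s) -> draws_mean T g <= draws_mean T h.
Proof.
by move=> gh; apply: ler_sum => s _; rewrite ler_wpM2l// prodr_ge0.
Qed.

(** The one-step bound holds for every sequence, so the last draw can be averaged out first;
    induction then descends to time [0]. *)
Lemma draws_mean_supermartingale (Phi : nat -> (nat -> 'I_n) -> K) T :
  (forall t s, \sum_i p i * Phi t.+1 (draws_set s t i) <= Phi t s) ->
  draws_mean T (Phi T) <= Phi 0 (fun=> i0).
Proof.
move=> PhiS; elim: T => [|T IH]; first by rewrite draws_mean0.
by rewrite draws_meanS (le_trans _ IH)// draws_mean_le.
Qed.

Lemma draws_meanD T g h :
  draws_mean T (fun s => g s + h s) = draws_mean T g + draws_mean T h.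
Proof. by rewrite -big_split; apply: eq_bigr => s _; rewrite mulrDr. Qed.

Lemma draws_meanZ T a g :
  draws_mean T (fun s => a * g s) = a * draws_mean T g.
Proof. by rewrite mulr_sumr; apply: eq_bigr => s _; rewrite mulrCA. Qed.

Lemma draws_mean_cst T a : \sum_i p i = 1 -> draws_mean T (fun=> a) = a.
Proof.
move=> p1; elim: T => [|T IH]; first by rewrite draws_mean0.
by rewrite draws_meanS -mulr_suml p1 mul1r.
Qed.

(** As [g] sees only the first [T] draws, it is a finite combination of indicators of cylinders,
    whose probabilities the product rule gives. Nonnegativity lets the integral pass through the
    sum. *)
Lemma expectation_iid_draws disp (Omega : measurableType disp)
    (P : probability Omega K) (xi : nat -> Omega -> 'I_n) T
    (g : (nat -> 'I_n) -> K) :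
  iid_draws P p xi -> (forall s, 0 <= g s) ->
  (forall s s', (forall t, (t < T)%N -> s t = s' t) -> g s = g s') ->
  'E_P[fun w => g (fun t => xi t w)]%E = (draws_mean T g)%:E.
Proof.
move=> [xi_meas xi_p xi_indep] g_ge0 g_loc.
pose J := [fset t in iota 0 T]%fset.
pose cyl (s : {ffun 'I_T -> 'I_n}) :=
  \bigcap_(t in [set` J]) (xi t @^-1` [set draws_ext s t]).
have JE t : (t \in J) = (t < T)%N by rewrite /J in_fset mem_iota.
have cylP s w : cyl s w <-> forall t : 'I_T, xi t w = s t.
  split=> [sw t|sw t /=]; first by rewrite -draws_extE; apply: sw; rewrite /= JE.
  by rewrite JE => tT; have := sw (Ordinal tT); rewrite -draws_extE.
have cyl_meas s : measurable (cyl s).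
  by apply: fin_bigcap_measurable => // t _; exact: xi_meas.
have P_cyl s : P (cyl s) = (\prod_t p (s t))%:E.
  rewrite xi_indep (perm_big (index_iota 0 T)); last first.
    apply: uniq_perm; rewrite ?fset_uniq ?iota_uniq// => t.
    by rewrite JE mem_index_iota.
  rewrite (big_morph _ (@EFinM K) erefl) big_mkord.
  by apply: eq_bigr => t _; rewrite xi_p draws_extE.
(* Exactly one cylinder contains [w], that of its own draws, so a single summand survives. *)
have gE w : (g (fun t => xi t w))%:E =
    (\sum_(s : {ffun 'I_T -> 'I_n}) ((g (draws_ext s))%:E * (\1_(cyl s) w)%:E))%E.
  pose s : {ffun 'I_T -> 'I_n} := [ffun t : 'I_T => xi t w].
  rewrite (bigD1 s)//= big1 ?adde0 => [|s' s's].
    rewrite indicE mem_set ?mule1.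
      congr EFin; apply: g_loc => t tT.
      by rewrite -[t]/(val (Ordinal tT)) draws_extE ffunE.
    by apply/cylP => t; rewrite ffunE.
  rewrite indicE memNset ?mule0// => /cylP s'w; move/eqP: s's; apply.
  by apply/ffunP => t; rewrite ffunE s'w.
rewrite unlock; under eq_integral do rewrite gE.
rewrite ge0_integral_sum//; last 2 first.
- move=> s; apply: measurable_funeM; apply/measurable_EFinP.
  exact: measurable_indic.
- by move=> s w _; rewrite mule_ge0// lee_fin.
rewrite /draws_mean -sumEFin; apply: eq_bigr => s _.
have indic_meas : measurable_fun setT (fun w => (\1_(cyl s) w : K)%:E).
  by apply/measurable_EFinP; exact: measurable_indic.
rewrite ge0_integralZl// ?lee_fin// integral_indic// setIT.
by rewrite mulrC EFinM; congr (_ * _)%E; exact: P_cyl.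
Qed.

End Draws.

(** * Dependence of the iterates on the draws, and convexity of the objective *)

Section Iterates.
Variables (K : realType) (n d : nat) (A : 'M[K]_(n, d)) (b : 'cV[K]_n).
Variables (Z : set 'cV[K]_d) (H : 'M[K]_d) (p : 'I_n -> K) (eta : K).
Variable x0 : 'cV[K]_d.
Let iter := pwsgd_iter A b Z H p eta x0.
Let output := pwsgd_output A b Z H p eta x0.
Let f := l1_objective A b.

Lemma pwsgd_iter_loc (s s' : nat -> 'I_n) t :
  (forall k, (k < t)%N -> s k = s' k) -> iter s t = iter s' t.
Proof.
rewrite /iter; elim: t => //= t IH ss'; rewrite ss'// IH// => k kt.
exact/ss'/ltnW.
Qed.

Lemma pwsgd_output_loc (s s' : nat -> 'I_n) T :
  (forall k, (k < T.+1)%N -> s k = s' k) -> output s T = output s' T.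
Proof.
move=> ss'; congr (_ *: _); apply: eq_bigr => t _.
apply: pwsgd_iter_loc => k kt; apply: ss'; exact: ltn_trans kt (ltn_ord t).
Qed.

(** Jensen's inequality: spreading [b] over the [T.+1] terms reduces it to the triangle
    inequality. *)
Lemma l1_objective_output_le s T :
  f (output s T) <= T.+1%:R^-1 * \sum_(t < T.+1) f (iter s t).
Proof.
rewrite -[T.+1%:R^-1]ger0_norm ?invr_ge0// {2}/f /l1_objective.
apply: le_trans (ler_wpM2l (normr_ge0 _) (norm1_sum _ _)).
rewrite -norm1Z sumrB sumr_const card_ord scalerBr.
rewrite -[b *+ _]scaler_nat scalerA.
by rewrite mulVf ?pnatr_eq0// scale1r /f /l1_objective -scalemxAr mulmx_sumr.
Qed.

End Iterates.

(** * Geometry of the [H]-norm and projection onto a closed convex set *)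

Section Projection.
Variables (K : realType) (d : nat) (F : 'M[K]_d).
Hypothesis F_unit : F \in unitmx.
Let H : 'M[K]_d := invmx (F *m F^T).

(** Makes the [H]-norm of [x] the Euclidean norm of [invmx F *m x]. *)
Let H_fact : H = (invmx F)^T *m invmx F.
Proof.
rewrite /H; have FFu : F *m F^T \in unitmx by rewrite unitmx_mul unitmx_tr F_unit.
apply: (can_inj (mulKmx FFu)); rewrite mulmxV// trmx_inv mulmxA.
by rewrite -[F *m _ *m _]mulmxA mulmxV ?unitmx_tr// mulmx1 mulmxV.
Qed.

Lemma sqnormE (x : 'cV[K]_d) :
  sqnorm H x = \sum_i ((invmx F *m x) i ord0) ^+ 2.
Proof.
rewrite /sqnorm H_fact mulmxA -mulmxA -trmx_mul mxE.
by apply: eq_bigr => i _; rewrite mxE expr2.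
Qed.

Lemma sqnorm_ge0 (x : 'cV[K]_d) : 0 <= sqnorm H x.
Proof. by rewrite sqnormE sumr_ge0// => i _; rewrite sqr_ge0. Qed.

(** Writes [x] as [F] applied to [invmx F *m x], whose maximum norm is at most its Euclidean norm.
    This gives the coercivity needed for projections and the definiteness of [H]. *)
Lemma mx_norm_sqr_le_sqnorm (x : 'cV[K]_d) :
  `|x| ^+ 2 <= norm1 F ^+ 2 * sqnorm H x.
Proof.
have /= Nle : `|x| <= norm1 F * `|invmx F *m x|.
  by rewrite (le_trans _ (norm1_mulmx_cV _ _))// mulKVmx// mx_norm_le_norm1.
rewrite (le_trans (ler_pM _ _ Nle Nle))// -expr2 exprMn ler_wpM2l ?sqr_ge0//.
rewrite -(sqr_sqrtr (sqnorm_ge0 x)) ler_sqr ?nnegrE ?sqrtr_ge0//.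
apply: mx_norm_le => [|i j]; first exact: sqrtr_ge0.
rewrite ord1 -sqrtr_sqr ler_wsqrtr// sqnormE (bigD1 i)//= lerDl.
by rewrite sumr_ge0// => k _; rewrite sqr_ge0.
Qed.

Definition dotH (x y : 'cV[K]_d) : K := (x^T *m H *m y) ord0 ord0.

Lemma dotHC x y : dotH x y = dotH y x.
Proof.
rewrite /dotH -[in LHS](trmxK (x^T *m H *m y)) [in LHS]mxE trmx_mul trmx_mul.
by rewrite trmxK H_fact trmx_mul trmxK mulmxA.
Qed.

Lemma sqnormD x y : sqnorm H (x + y) = sqnorm H x + 2 * dotH x y + sqnorm H y.
Proof.
rewrite mulr_natl mulr2n {2}dotHC /sqnorm /dotH.
rewrite [(x + y)^T]raddfD /= !mulmxDl !mulmxDr !mxE.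
ring.
Qed.

Lemma dotHZr a x y : dotH x (a *: y) = a * dotH x y.
Proof. by rewrite /dotH -scalemxAr mxE. Qed.

Lemma sqnormZ a x : sqnorm H (a *: x) = a ^+ 2 * sqnorm H x.
Proof. by rewrite /sqnorm [(a *: x)^T]linearZ /= -!scalemxAl -scalemxAr !mxE mulrA. Qed.

Lemma sqnormN x : sqnorm H (- x) = sqnorm H x.
Proof. by rewrite -scaleN1r sqnormZ sqrrN expr1n mul1r. Qed.

(** The sublevel set through a known point [z] of [Z] is compact, and points of [Z] outside it do
    worse than [z]. *)
Lemma sqnorm_proj_exists (Z : set 'cV[K]_d) (u : 'cV[K]_d) :
  Z !=set0 -> closed Z -> exists x, is_argmin Z (fun y => sqnorm H (u - y)) x.
Proof.
move=> [z Zz] Zcl.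
(* Compactness of bounded closed sets is available for row vectors only. *)
pose g (v : 'rV[K]_d) := sqnorm H (u - v^T).
have trC : continuous (fun v : 'rV[K]_d => v^T).
  move=> v B /= /(nbhs_ballP v^T)[e e0 eB]; apply/nbhs_ballP; exists e => //= w.
  by move=> [_ vw]; apply: eB; split=> // i j; rewrite !mxE.
have linC i : continuous (fun v : 'rV[K]_d =>
    (invmx F *m u) i ord0 - \sum_j invmx F i j * v ord0 j).
  move=> v; apply: continuousB; first exact: cst_continuous.
  apply: continuous_big => [|j _]; first exact: add_continuous.
  move=> w; apply: continuousM; first exact: cst_continuous.
  exact: coord_continuous.
have gC : continuous g.
  have -> : g = fun v => \sum_i ((invmx F *m u) i ord0 -
      \sum_j invmx F i j * v ord0 j) ^+ 2.
    apply/funext => v; rewrite /g sqnormE; apply: eq_bigr => i _.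
    rewrite mulmxBr !mxE; congr (((_ - _) ^+ 2)).
    by apply: eq_bigr => j _; rewrite mxE.
  apply: continuous_big => [|i _ v]; first exact: add_continuous.
  exact: (continuous_comp (linC i v) (@exprn_continuous K 2 _)).
pose A := [set v : 'rV[K]_d | Z v^T /\ g v <= g z^T].
have A0 : A !=set0 by exists z^T; rewrite /A /= trmxK.
have Acl : closed A.
  apply: closedI.
    by move/continuous_closedP : trC; apply.
  by move/continuous_closedP : gC => /(_ _ (@closed_le _ (g z^T))).
have Abd : bounded_set A.
  exists (norm1 F * Num.sqrt (g z^T) + `|u|); split; first exact: num_real.
  move=> M ltM v [_ gv]; apply: le_trans (ltW ltM).
  have normT : `|v| <= `|v^T|.
    by apply: mx_norm_le => // i j; have := ler_mx_norm v^T j i; rewrite mxE.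
  apply: (le_trans normT); have -> : v^T = - (u - v^T) + u.
    by rewrite opprB subrK.
  rewrite (le_trans (ler_normD _ _))// lerD2r normrN.
  rewrite -ler_sqr ?nnegrE ?mulr_ge0 ?norm1_ge0 ?sqrtr_ge0//.
  rewrite (le_trans (mx_norm_sqr_le_sqnorm _))// exprMn sqr_sqrtr ?sqnorm_ge0//.
  by rewrite ler_wpM2l ?sqr_ge0.
have [v] := compact_EVT_min A0 (bounded_closed_compact Abd Acl) (continuous_subspaceT gC).
rewrite inE => -[Zv gvz] gmin; exists v^T; split => // y Zy.
have [yz|zy] := leP (g y^T) (g z^T).
  have /gmin : y^T \in A by rewrite inE /A /= trmxK.
  by rewrite /g trmxK.
by rewrite (le_trans gvz)// (le_trans (ltW zy))// /g trmxK.
Qed.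

(** Minimality forces [0 <= D]: otherwise a move from [x] towards [y] would come closer to [u].
    Expanding the square of [y - u] around [x] then concludes. *)
Lemma sqnorm_proj_obtuse (Z : set 'cV[K]_d) (u x y : 'cV[K]_d) :
  convex_set Z -> is_argmin Z (fun y => sqnorm H (u - y)) x -> Z y ->
  sqnorm H (y - x) <= sqnorm H (y - u).
Proof.
move=> Zcvx [Zx xmin] Zy.
set D := dotH (x - u) (y - x); set S := sqnorm H (y - x).
have S0 : 0 <= S := sqnorm_ge0 _.
have Eyu : sqnorm H (y - u) = sqnorm H (x - u) + 2 * D + S.
  by rewrite -sqnormD [x - u + _]addrC addrA subrK.
suff D0 : 0 <= D by rewrite Eyu lerDr addr_ge0 ?sqnorm_ge0// mulr_ge0.
rewrite leNgt; apply/negP => D0.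
have SD0 : 0 < S - D by lra.
(* The quadratic along the segment is smallest at [- D / S]; the larger denominator makes
   [0 < t <= 1] follow from [0 <= S] and [D < 0], and the distance to [u] still decreases. *)
pose t := - D / (S - D).
have t0 : 0 < t by rewrite divr_gt0// oppr_gt0.
have t1 : t <= 1 by rewrite ler_pdivrMr// mul1r; lra.
have Zt : Z (x + t *: (y - x)).
  have yZ : y \in Z by rewrite inE.
  have xZ : x \in Z by rewrite inE.
  have := Zcvx _ _ (Itv01 (ltW t0) t1) yZ xZ; rewrite inE.
  congr Z; rewrite [LHS]/(t *: y + (1 - t) *: x).
  by rewrite scalerBl scale1r scalerBr addrCA.
have := xmin _ Zt.
rewrite -(sqnormN (u - x)) -(sqnormN (u - _)) !opprB addrAC [leRHS]sqnormD dotHZr sqnormZ.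
rewrite -/D -/S -addrA lerDl.
have -> : 2 * (t * D) + t ^+ 2 * S = t * (D * (S - 2 * D) / (S - D)).
  by rewrite /t; field; rewrite gt_eqF.
rewrite pmulr_rge0// pmulr_lge0 ?invr_gt0// nmulr_rge0//; lra.
Qed.

(** [F *m F^T] inverts [H], so this vector represents the linear form [a] in the [H]-inner
    product. *)
Lemma dotH_grad (x : 'cV[K]_d) (a : 'rV[K]_d) :
  dotH x (F *m F^T *m a^T) = (a *m x) ord0 ord0.
Proof.
rewrite /dotH /H -mulmxA mulKmx ?unitmx_mul ?unitmx_tr ?F_unit//.
by rewrite -trmx_mul mxE.
Qed.

Lemma sqnorm_grad_le (a : 'rV[K]_d) :
  sqnorm H (F *m F^T *m a^T) <= norm1 (a *m F) ^+ 2.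
Proof.
rewrite sqnormE -mulmxA mulKmx// -trmx_mul -(norm1_tr (a *m F)).
exact: sum_sqr_le_norm1.
Qed.

Lemma argmin_shift (V : Type) (Z : set V) (g h : V -> K) (a c : K) (x : V) :
  0 < a -> (forall y, g y = a * h y + c) -> is_argmin Z g x <-> is_argmin Z h x.
Proof.
move=> a0 gh; split=> -[Zx xmin]; split=> // y /xmin.
  by rewrite !gh lerD2r ler_pM2l.
by rewrite !gh lerD2r ler_pM2l.
Qed.

(** * One-step inequality and the resulting bound for the averaged iterate *)

Section Step.
Variables (n : nat) (A : 'M[K]_(n, d)) (b : 'cV[K]_n) (Z : set 'cV[K]_d).
Hypotheses (Z_closed : closed Z) (Z_convex : convex_set Z).
Variables (p : 'I_n -> K) (eta : K).
Let coef := pwsgd_coef A b p.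
Let step := pwsgd_step A b Z H p eta.

(* Completing the square shows that the step is the [H]-orthogonal projection
   onto [Z] of the unconstrained gradient step. *)
Lemma pwsgd_step_le (x y : 'cV[K]_d) (i : 'I_n) : Z y ->
  sqnorm H (y - step x i) <= sqnorm H (y - x)
    + 2 * eta * coef x i * (row i A *m (y - x)) ord0 ord0
    + (eta * coef x i) ^+ 2 * norm1 (row i A *m F) ^+ 2.
Proof.
move=> Zy; pose w := (eta * coef x i) *: (F *m F^T *m (row i A)^T).
pose u := x - w.
have dotw v : dotH v w = eta * coef x i * (row i A *m v) ord0 ord0.
  by rewrite dotHZr dotH_grad.
have shift z : pwsgd_model A b H p eta x i z = 2^-1 * sqnorm H (u - z) +
    (eta * coef x i * (row i A *m u) ord0 ord0 + 2^-1 * sqnorm H w).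
  rewrite /pwsgd_model -/(coef x i).
  have -> : x - z = (u - z) + w by rewrite addrAC subrK.
  have rowB : (row i A *m (u - z)) ord0 ord0 =
      (row i A *m u) ord0 ord0 - (row i A *m z) ord0 ord0.
    by rewrite mulmxBr [LHS]mxE [X in _ + X = _]mxE.
  rewrite sqnormD dotw rowB.
  by field.
have [x' x'min] := sqnorm_proj_exists u (ex_intro _ y Zy) Z_closed.
have stepP : is_argmin Z (fun z => sqnorm H (u - z)) (step x i).
  apply/(argmin_shift _ _ _ shift); first by rewrite invr_gt0.
  (* The existence of a minimizer rules out the default value [x] of [xget]. *)
  rewrite /step /pwsgd_step; apply: (@xgetPex _ x).
  by exists x'; apply/(argmin_shift _ _ _ shift); first by rewrite invr_gt0.
apply: (le_trans (sqnorm_proj_obtuse Z_convex stepP Zy)).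
have -> : y - u = (y - x) + w by rewrite opprB addrA addrAC.
rewrite sqnormD dotw sqnormZ (mulrA 2) (mulrA 2 eta) lerD2l ler_wpM2l ?sqr_ge0//.
exact: sqnorm_grad_le.
Qed.

Hypotheses (p_ge0 : forall i, 0 <= p i) (p_sum : \sum_i p i = 1).
Hypothesis eta_gt0 : 0 < eta.
Variable G : K.
Hypothesis row_le : forall i, norm1 (row i A *m F) <= p i * G.

(** The sign of a residual is a subgradient of the absolute value there, and the weight [p i]
    cancels the division in [coef]. *)
Lemma subgradient_le (x y : 'cV[K]_d) (i : 'I_n) :
  p i * coef x i * (row i A *m (y - x)) ord0 ord0 <=
  `|(A *m y - b) i ord0| - `|(A *m x - b) i ord0|.
Proof.
have -> : (row i A *m (y - x)) ord0 ord0 =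
    (A *m y - b) i ord0 - (A *m x - b) i ord0.
  rewrite -row_mul mulmxBr 2![in LHS]mxE [X in _ + X = _]mxE.
  by rewrite [(A *m y - b) _ _]mxE [(A *m x - b) _ _]mxE; ring.
(* If [p i = 0] then row [i] of [A] vanishes, and nothing is lost by never drawing
   [i]. *)
have [pi0|pi_neq0] := eqVneq (p i) 0; last first.
  rewrite /coef /pwsgd_coef mulrCA mulfV// mulr1 mulrBr -normrEsg lerD2r.
  rewrite (le_trans (ler_norm _))// normrM ler_piMl// normr_sg.
  by case: eqP.
have /eqP : row i A *m F = 0.
  apply/eqP; rewrite -norm1_eq0 eq_le norm1_ge0 andbT.
  by have := row_le i; rewrite pi0 mul0r.
rewrite -(mul0mx _ F) (can_eq (mulmxK F_unit)) => /eqP rowi0.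
have AE z : (A *m z) i ord0 = 0.
  by have /rowP/(_ ord0) := row_mul i A z; rewrite rowi0 mul0mx !mxE.
by rewrite pi0 !mul0r ![(_ - b) _ _]mxE !AE subrr.
Qed.

(** Averages the one-step bound over [i]. When [p i] is positive, [coef x i] is at most [1 / p i] in
    absolute value, so [row_le] bounds the quadratic term by [(eta * G) ^+ 2]. *)
Lemma pwsgd_step_mean_le (x y : 'cV[K]_d) : Z y ->
  \sum_i p i * sqnorm H (y - step x i) <= sqnorm H (y - x)
    - 2 * eta * (l1_objective A b x - l1_objective A b y) + (eta * G) ^+ 2.
Proof.
move=> Zy.
have -> : sqnorm H (y - x) - 2 * eta * (l1_objective A b x - l1_objective A b y)
    + (eta * G) ^+ 2 = \sum_i (p i * sqnorm H (y - x) +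
      2 * eta * (`|(A *m y - b) i ord0| - `|(A *m x - b) i ord0|) +
      p i * (eta * G) ^+ 2).
  rewrite 2!big_split -!mulr_suml p_sum !mul1r -mulr_sumr /= sumrB.
  by rewrite -!norm1_cV -mulrN opprB.
apply: ler_sum => i _.
apply: (le_trans (ler_wpM2l (p_ge0 i) (pwsgd_step_le x i Zy))).
rewrite 2!mulrDr; apply: lerD.
  rewrite lerD2l.
  have -> : p i * (2 * eta * coef x i * (row i A *m (y - x)) ord0 ord0) =
    2 * eta * (p i * coef x i * (row i A *m (y - x)) ord0 ord0) by ring.
  by rewrite ler_wpM2l ?subgradient_le// mulr_ge0// ltW.
rewrite ler_wpM2l// -exprMn -mulrA exprMn [leRHS]exprMn ler_wpM2l ?sqr_ge0//.
(* For [p i = 0] the coefficient vanishes, the inverse of [0] being [0]. *)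
have [pi0|pi_neq0] := eqVneq (p i) 0.
  by rewrite /coef /pwsgd_coef pi0 invr0 mulr0 mul0r expr0n sqr_ge0.
have pi_gt0 : 0 < p i by rewrite lt_neqAle eq_sym pi_neq0 p_ge0.
rewrite -real_normK ?num_real// ler_sqr ?nnegrE//; last first.
  rewrite -(pmulr_rge0 _ pi_gt0); exact: le_trans (norm1_ge0 _) (row_le i).
rewrite normrM (ger0_norm (norm1_ge0 _)) /coef /pwsgd_coef normrM normfV.
rewrite (gtr0_norm pi_gt0) mulrAC ler_pdivrMr// [leRHS]mulrC.
apply: le_trans (row_le i); rewrite ler_piMl ?norm1_ge0// normr_sg.
by case: eqP.
Qed.

Variable x0 : 'cV[K]_d.
Let iter := pwsgd_iter A b Z H p eta x0.
Let output := pwsgd_output A b Z H p eta x0.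
Let f := l1_objective A b.

(** The supermartingale [Phi] starts at the initial squared distance and controls the mean of the
    accumulated excess [S]; convexity passes from [S] to the average. *)
Lemma draws_mean_output_le (i0 : 'I_n) (y : 'cV[K]_d) T : Z y ->
  draws_mean p i0 T.+1 (fun s => f (output s T)) <= f y +
    (sqnorm H (y - x0) + T.+1%:R * (eta * G) ^+ 2) / (2 * eta * T.+1%:R).
Proof.
move=> Zy; set N := T.+1%:R.
have N_gt0 : 0 < N :> K by rewrite ltr0n.
pose S t s := \sum_(k < t) (f (iter s k) - f y).
pose Phi (t : nat) s :=
  2 * eta * S t s + sqnorm H (y - iter s t) - t%:R * (eta * G) ^+ 2.
have PhiS t s : \sum_i p i * Phi t.+1 (draws_set s t i) <= Phi t s.
  (* The draw at time [t] influences only the iterates after [t]. *)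
  have iter_set i k : (k <= t)%N -> iter (draws_set s t i) k = iter s k.
    move=> kt; apply: pwsgd_iter_loc => j jk; rewrite /draws_set ifF//.
    by apply/negbTE; rewrite neq_ltn (leq_trans jk kt).
  have PhiE i : Phi t.+1 (draws_set s t i) = sqnorm H (y - step (iter s t) i) +
      (2 * eta * (S t s + (f (iter s t) - f y)) - t.+1%:R * (eta * G) ^+ 2).
    have -> : step (iter s t) i = iter (draws_set s t i) t.+1.
      by rewrite -(iter_set i t (leqnn t)) /iter /= [draws_set s t i t]/draws_set eqxx.
    have SE : S t.+1 (draws_set s t i) = S t s + (f (iter s t) - f y).
      rewrite /S big_ord_recr /= iter_set//; congr (_ + _).
      by apply: eq_bigr => k _; rewrite iter_set// ltnW.
    by rewrite /Phi SE; ring.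
  under eq_bigr do rewrite PhiE mulrDr.
  rewrite big_split -mulr_suml p_sum mul1r /=.
  have := pwsgd_step_mean_le (iter s t) Zy; rewrite -/f /Phi -natr1 => /le_trans.
  rewrite -lerBrDr; apply.
  by rewrite le_eqVlt; apply/orP; left; apply/eqP; ring.
have := draws_mean_supermartingale i0 p_ge0 T.+1 PhiS.
have -> : Phi 0%N (fun=> i0) = sqnorm H (y - x0).
  by rewrite /Phi /S big_ord0 mulr0 add0r mul0r subr0.
(* With this factor, [a * (2 * eta * S T.+1 s)] is the average excess over the [N] iterates. *)
move=> meanPhi; pose a := (2 * eta * N)^-1.
have a_gt0 : 0 < a by rewrite invr_gt0 !mulr_gt0.
apply: (@le_trans _ _ (f y + a * (draws_mean p i0 T.+1 (Phi T.+1) +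
    N * (eta * G) ^+ 2))); last first.
  by rewrite lerD2l mulrC ler_wpM2r ?(ltW a_gt0)// lerD2r.
rewrite -[X in _ + a * (_ + X)](draws_mean_cst i0 T.+1 _ p_sum).
rewrite -draws_meanD -draws_meanZ -[X in X + _](draws_mean_cst i0 T.+1 _ p_sum).
rewrite -draws_meanD; apply: draws_mean_le => // s.
apply: (le_trans (l1_objective_output_le _ _ _ _ _ _ _ s T)).
have -> : \sum_(t < T.+1) f (iter s t) = S T.+1 s + N * f y.
  by rewrite /S sumrB sumr_const card_ord -mulr_natl subrK.
rewrite -/N /Phi -/N subrK.
have -> : N^-1 * (S T.+1 s + N * f y) = f y + a * (2 * eta * S T.+1 s).
  by rewrite /a; field; rewrite !gt_eqF.
by rewrite lerD2l ler_wpM2l ?(ltW a_gt0)// lerDl sqnorm_ge0.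
Qed.

End Step.

(** Rewrites [invmx F *m x] as [invmx (R *m F)] applied to [R *m x], and bounds the Euclidean norm
    by the [l1] norm. *)
Lemma sqnorm_le_mx_norm (R : 'M[K]_d) (x : 'cV[K]_d) : R \in unitmx ->
  sqnorm H x <= (norm1 (invmx (R *m F)) * `|R *m x|) ^+ 2.
Proof.
move=> R_unit; rewrite sqnormE (le_trans (sum_sqr_le_norm1 _))//.
have -> : invmx F *m x = invmx (R *m F) *m (R *m x).
  have RF_unit : R *m F \in unitmx by rewrite unitmx_mul R_unit.
  by apply: (canRL (mulKmx RF_unit)); rewrite -mulmxA mulKVmx.
by rewrite ler_sqr ?nnegrE ?mulr_ge0 ?norm1_ge0// norm1_mulmx_cV.
Qed.

End Projection.

(** For nonzero [z], multiplying the two conditions on an admissible pair and dividing by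
    [norm1 (U *m z)] bounds every [alpha * beta] from below, hence also their infimum. *)
Lemma kappa_bar1_le (K : realType) n d (U : 'M[K]_(n, d)) (z : 'cV[K]_d) :
  row_free U^T -> norm1 U * `|z| <= kappa_bar1 U * norm1 (U *m z).
Proof.
move=> U_free.
have [V VU] : exists V : 'M[K]_(d, n), V *m U = 1%:M.
  have [W UW] := row_freeP U_free.
  by exists W^T; apply: trmx_inj; rewrite trmx_mul trmxK UW trmx1.
have norm_le (x : 'cV_d) : `|x| <= norm1 V * norm1 (U *m x).
  rewrite -[x in leLHS]mul1mx -VU -mulmxA.
  exact: le_trans (mx_norm_le_norm1 _) (norm1_mulmx _ _).
have [z0|z_neq0] := eqVneq z 0.
  by rewrite z0 normr0 mulmx0 (eqP (_ : norm1 0 == 0)) ?norm1_eq0// !mulr0.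
have z_gt0 : 0 < `|z| by rewrite normr_gt0.
have Uz_gt0 : 0 < norm1 (U *m z).
  rewrite lt_neqAle norm1_ge0 andbT eq_sym; apply/eqP => Uz0.
  by have := norm_le z; rewrite Uz0 mulr0 leNgt z_gt0.
rewrite -ler_pdivrMr//; apply: lb_le_inf.
  (* The left inverse [V] supplies an admissible [beta], so the infimum is over a nonempty set. *)
  exists (norm1 U * norm1 V), (norm1 U), (norm1 V); split => //.
move=> _ [alpha [beta [[U_le beta_le] ->]]].
have beta_gt0 : 0 < beta.
  by rewrite -(pmulr_lgt0 _ Uz_gt0) (lt_le_trans z_gt0).
rewrite ler_pdivrMr// (le_trans (ler_wpM2l (norm1_ge0 _) (beta_le z)))//.
by rewrite mulrA ler_wpM2r ?norm1_ge0// ler_wpM2r// ltW.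
Qed.

(** The nonzero [x] excludes [m = 0], where the identity matrix is zero. *)
Lemma norm1_gt0 (K : realType) m n (M : 'M[K]_(m, n)) (N : 'M[K]_(n, m))
    (x : 'cV[K]_m) : M *m N = 1%:M -> x != 0 -> 0 < norm1 M.
Proof.
move=> MN x_neq0; rewrite lt_neqAle norm1_ge0 andbT eq_sym norm1_eq0.
apply: contra_neq x_neq0 => M0.
by rewrite -[x]mul1mx -MN M0 !mul0mx.
Qed.

(** * Sampling probabilities from approximate leverage scores *)

Section LeverageScores.
Variables (K : realType) (n d : nat) (U : 'M[K]_(n, d)) (gamma : K).
Variable lambda : 'I_n -> K.
Hypothesis gamma_lt1 : gamma < 1.
Hypothesis lambda_approx : approx_leverage_scores gamma U lambda.
Hypothesis U_gt0 : 0 < norm1 U.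
Let p := fun i => lambda i / \sum_(j < n) lambda j.

Lemma leverage_sum_bounds :
  0 < \sum_j lambda j <= (1 + gamma) * norm1 U.
Proof.
apply/andP; split; last first.
  by rewrite norm1_rows mulr_sumr; apply: ler_sum => j _; case/andP: (lambda_approx j).
apply: (@lt_le_trans _ _ ((1 - gamma) * norm1 U)).
  by rewrite mulr_gt0// subr_gt0.
by rewrite norm1_rows mulr_sumr; apply: ler_sum => j _; case/andP: (lambda_approx j).
Qed.

Lemma leverage_ge0 i : 0 <= lambda i.
Proof.
case/andP: (lambda_approx i) => + _; apply: le_trans.
by rewrite mulr_ge0 ?norm1_ge0// subr_ge0 ltW.
Qed.

Lemma leverage_prob_ge0 i : 0 <= p i.
Proof.
by have /andP[/ltW ? _] := leverage_sum_bounds; rewrite divr_ge0// leverage_ge0.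
Qed.

Lemma leverage_prob_sum : \sum_i p i = 1.
Proof.
have /andP[/gt_eqF/negbT s_neq0 _] := leverage_sum_bounds.
by rewrite -mulr_suml mulfV.
Qed.

(** The lower bound on [lambda i] and the upper bound on the sum of the scores combine into the
    factor [(1 + gamma) / (1 - gamma)]. *)
Lemma norm1_row_le_leverage_prob i :
  norm1 (row i U) <= p i * ((1 + gamma) / (1 - gamma) * norm1 U).
Proof.
have /andP[s_gt0 s_le] := leverage_sum_bounds.
have g_gt0 : 0 < 1 - gamma by rewrite subr_gt0.
have /andP[low _] := lambda_approx i.
rewrite /p mulrAC ler_pdivlMr// mulrA mulrAC mulrA ler_pdivlMr//.
rewrite mulrAC [leLHS]mulrC [leRHS]mulrAC -[leRHS]mulrA.
rewrite [leLHS]mulrA ler_pM ?mulr_ge0 ?norm1_ge0 ?(ltW g_gt0) ?(ltW s_gt0)//.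
by rewrite mulrC.
Qed.

End LeverageScores.

(** * Choice of the step size and final estimate *)

Theorem proposition5 (K : realType) (q : {poly K}) (n d : nat)
    (A : 'M[K]_(n, d)) (b : 'cV[K]_n) (Z : set 'cV[K]_d)
    (xstar x0 : 'cV[K]_d) (R F H : 'M[K]_d) (U : 'M[K]_(n, d))
    (gamma : K) (lambda : 'I_n -> K)
    (rankA : \rank A = d)
    (Z_nonempty : Z !=set0) (Z_closed : closed Z) (Z_convex : convex_set Z)
    (xstar_opt : is_argmin Z (l1_objective A b) xstar)
    (fxstar_gt0 : 0 < l1_objective A b xstar)
    (xstar_neq0 : xstar != 0)
    (R_unit : R \in unitmx) (F_unit : F \in unitmx)
    (U_def : U = A *m invmx R) (U_wcb : well_conditioned_basis q A U)
    (H_def : H = invmx (F *m F^T))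
    (gamma_ge0 : 0 <= gamma) (gamma_lt1 : gamma < 1)
    (lambda_approx : approx_leverage_scores gamma U lambda)
    (Zx0 : Z x0) :
  let f := l1_objective A b in
  let p := fun i => lambda i / \sum_(j < n) lambda j in
  let c1 := (1 + gamma) / (1 - gamma) in
  let c2 := sqnorm H (xstar - x0) / sqnorm H xstar in
  let c3 := norm1 (A *m xstar) / f xstar in
  forall epsilon : K, 0 < epsilon ->
  exists eta : K, 0 < eta /\
    forall T : nat,
      d%:R * kappa_bar1 U ^+ 2 * kappa_hat (R *m F) ^+ 2
        * (c1 ^+ 2 * c2 * c3 ^+ 2 / epsilon ^+ 2) <= T%:R ->
    forall (disp : measure_display) (Omega : measurableType disp)
      (P : probability Omega K) (xi : nat -> Omega -> 'I_n),
      iid_draws P p xi ->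
      (('E_P[fun w => f (pwsgd_output A b Z H p eta x0 (fun t => xi t w) T)]
          - (f xstar)%:E) / (f xstar)%:E <= epsilon%:E)%E.
Proof.
move=> f p c1 c2 c3 epsilon eps_gt0.
have U_free : row_free U^T by case: U_wcb.
have U_gt0 : 0 < norm1 U.
  have [W UW] := row_freeP U_free.
  by rewrite -norm1_tr (norm1_gt0 UW xstar_neq0).
have RF_unit : R *m F \in unitmx by rewrite unitmx_mul R_unit.
have RF_gt0 : 0 < norm1 (R *m F) by apply: norm1_gt0 (mulmxV RF_unit) xstar_neq0.
have c1_gt0 : 0 < c1 by rewrite divr_gt0 ?subr_gt0// ltr_wpDr.
have d_ge1 : 1 <= d%:R :> K.
  rewrite ler1n lt0n; apply: contra_neq xstar_neq0 => d0.
  by apply/colP => i; have := ltn_ord i; rewrite {2}d0.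
have n_gt0 : (0 < n)%N.
  rewrite lt0n; apply: contraTneq fxstar_gt0 => n0.
  by rewrite /l1_objective norm1_cV big1 ?ltxx// => i; have := ltn_ord i; rewrite {2}n0.
have AE : A = U *m R by rewrite U_def mulmxKV.
have sq_gt0 : 0 < sqnorm H xstar.
  rewrite H_def lt_neqAle (sqnorm_ge0 F_unit) andbT eq_sym.
  apply/eqP => sq0; have := mx_norm_sqr_le_sqnorm F_unit xstar.
  by rewrite sq0 mulr0 leNgt exprn_gt0// normr_gt0.
pose G := c1 * norm1 U * norm1 (R *m F).
have G_gt0 : 0 < G by rewrite mulr_gt0 // mulr_gt0.
pose e := epsilon * f xstar.
have e_gt0 : 0 < e by rewrite mulr_gt0.
have dist_le (T : nat) : d%:R * kappa_bar1 U ^+ 2 * kappa_hat (R *m F) ^+ 2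
    * (c1 ^+ 2 * c2 * c3 ^+ 2 / epsilon ^+ 2) <= T%:R ->
    sqnorm H (xstar - x0) * G ^+ 2 <= T%:R * e ^+ 2.
  (* [M] arises by trading [norm1 U] times the maximum norm of [R *m xstar] for
     [kappa_bar1 U * norm1 (A *m xstar)]; here the conditioning of the basis enters. *)
  move=> T_ge; pose M := c2 * (c1 * kappa_hat (R *m F) *
    (kappa_bar1 U * norm1 (A *m xstar))) ^+ 2.
  have c2_ge0 : 0 <= c2 by rewrite divr_ge0 ?(ltW sq_gt0)// H_def sqnorm_ge0.
  have M_ge0 : 0 <= M by rewrite mulr_ge0 ?sqr_ge0.
  apply: (@le_trans _ _ M).
    have -> : sqnorm H (xstar - x0) = c2 * sqnorm H xstar.
      by rewrite /c2 divfK ?gt_eqF.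
    rewrite -mulrA ler_wpM2l//.
    have := sqnorm_le_mx_norm F_unit xstar R_unit; rewrite -H_def => sq_le.
    rewrite (le_trans (ler_wpM2r (sqr_ge0 G) sq_le))// -exprMn.
    have := kappa_bar1_le (R *m xstar) U_free; rewrite mulmxA -AE => kappa_le.
    have -> : norm1 (invmx (R *m F)) * `|R *m xstar| * G =
        c1 * kappa_hat (R *m F) * (norm1 U * `|R *m xstar|).
      by rewrite /G /kappa_hat; ring.
    have ck_ge0 : 0 <= c1 * kappa_hat (R *m F).
      by rewrite mulr_ge0 ?(ltW c1_gt0)// mulr_ge0 ?norm1_ge0.
    have Rx_ge0 : 0 <= norm1 U * `|R *m xstar| by rewrite mulr_ge0 ?norm1_ge0.
    apply: lerXn2r; rewrite ?nnegrE; [exact: mulr_ge0| |exact: ler_wpM2l].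
    exact: mulr_ge0 ck_ge0 (le_trans Rx_ge0 kappa_le).
  apply: le_trans (ler_wpM2r (sqr_ge0 e) T_ge).
  have -> : d%:R * kappa_bar1 U ^+ 2 * kappa_hat (R *m F) ^+ 2 *
      (c1 ^+ 2 * c2 * c3 ^+ 2 / epsilon ^+ 2) * e ^+ 2 = d%:R * M.
    by rewrite /M /c3 /e; field; rewrite !gt_eqF.
  (* [1 <= d] absorbs the dimension factor. *)
  by rewrite ler_peMl.
have p_ge0 := leverage_prob_ge0 gamma_lt1 lambda_approx U_gt0.
have p_sum := leverage_prob_sum gamma_lt1 lambda_approx U_gt0.
have row_le i : norm1 (row i A *m F) <= p i * G.
  rewrite AE row_mul -mulmxA (le_trans (norm1_mulmx _ _))//.
  rewrite /G mulrA ler_wpM2r ?norm1_ge0//.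
  exact: norm1_row_le_leverage_prob.
(* Independent of [T]; the quadratic term then contributes [e / 2], and [dist_le] keeps the initial
   distance within the other half. *)
pose eta := e / G ^+ 2.
have eta_gt0 : 0 < eta by rewrite divr_gt0 ?exprn_gt0.
exists eta; split=> // T T_ge disp Omega P xi xi_iid.
pose i0 := Ordinal n_gt0.
pose X s := f (pwsgd_output A b Z H p eta x0 s T).
have E_le : draws_mean p i0 T.+1 X <= (1 + epsilon) * f xstar.
  have Zxs : Z xstar by case: xstar_opt.
  have := draws_mean_output_le F_unit b Z_closed Z_convex p_ge0 p_sum eta_gt0
    row_le x0 i0 T Zxs.
  rewrite -H_def => /le_trans; apply.
  rewrite [(1 + _) * _]mulrDl mul1r lerD2l -/e.
  have N_gt0 : 0 < T.+1%:R :> K by rewrite ltr0n.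
  rewrite ler_pdivrMr; last exact: mulr_gt0 (mulr_gt0 _ eta_gt0) N_gt0.
  have -> : (eta * G) ^+ 2 = e ^+ 2 / G ^+ 2.
    by rewrite /eta; field; rewrite gt_eqF.
  have -> : e * (2 * eta * T.+1%:R) = (2 * T.+1%:R * e ^+ 2) / G ^+ 2.
    by rewrite /eta; field; rewrite gt_eqF.
  rewrite ler_pdivlMr ?exprn_gt0//.
  have -> : (sqnorm H (xstar - x0) + T.+1%:R * (e ^+ 2 / G ^+ 2)) * G ^+ 2 =
      sqnorm H (xstar - x0) * G ^+ 2 + T.+1%:R * e ^+ 2.
    by field; rewrite gt_eqF.
  have -> : 2 * T.+1%:R * e ^+ 2 = T.+1%:R * e ^+ 2 + T.+1%:R * e ^+ 2 by ring.
  (* The average has [T.+1] terms while the hypothesis bounds [T]; the extra term only helps. *)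
  rewrite lerD2r (le_trans (dist_le T T_ge))//.
  by rewrite ler_wpM2r ?sqr_ge0// ler_nat.
rewrite (expectation_iid_draws i0 (T := T.+1) (g := X) xi_iid); last 2 first.
- by move=> s; exact: norm1_ge0.
- by move=> s s' ss'; rewrite /X (pwsgd_output_loc _ _ _ _ _ _ _ ss').
rewrite -EFinB inver gt_eqF// -EFinM lee_fin ler_pdivrMr// lerBlDr.
by rewrite addrC -[X in X + _]mul1r -mulrDl.
Qed.
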